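(* Let $\mathcal{H}=(\bm{Y},\bm{U},\bm{G},\mathbb{P}_{\bm{U}})$ be a structural causal model with set of admissible (soft) interventions $\mathcal{J}$. Let $V\in\bm{Y}$ and suppose that $\mathcal{J}$ contains two distinct interventions $j=(V\gets g)$ and $j'=(V\gets g')$ such that 1. for all $\bm{u}\in\mathrm{Val}(\bm{U})$, $\mathrm{Proj}(\mathcal{H}_j(\bm{u}),V)=\mathrm{Proj}(\mathcal{H}_{j'}(\bm{u}),V)$; 2. $\mathrm{Image}(g)=\mathrm{Image}(g')$. Then, for any structural causal model $\mathcal{L}$ with set of admissible interventions $\mathcal{I}$, whenever $\mathcal{H}$ is a low soft $\tau$-abstraction of $\mathcal{L}$, the corresponding function $\omega\colon\mathcal{I}\to\mathcal{J}$ is not uniquely defined; that is, there exist at least two distinct surjective functions $\mathcal{I}\to\mathcal{J}$ that satisfy the conditions required of $\omega$ in the definition of low soft $\tau$-abstraction.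
   Context: Each variable $V$ has a domain $\mathrm{Val}(V)$; for a set $\bm{V}$ of variables, $\mathrm{Val}(\bm{V})=\prod_{V\in\bm{V}}\mathrm{Val}(V)$. For $\bm{V}\subseteq\bm{X}$ and $\bm{x}\in\mathrm{Val}(\bm{X})$, $\mathrm{Proj}(\bm{x},\bm{V})\in\mathrm{Val}(\bm{V})$ is the restriction of $\bm{x}$ to the variables $\bm{V}$. A structural causal model (SCM) is a tuple $\mathcal{M}=(\bm{X},\bm{E},\bm{F},\mathbb{P}_{\bm{E}})$ with endogenous variables $\bm{X}$, exogenous variables $\bm{E}$, a family $\bm{F}$ of structural equations $F_X\colon\mathrm{Val}(\bm{X})\times\mathrm{Val}(\bm{E})\to\mathrm{Val}(X)$, $X\in\bm{X}$, and a probability measure $\mathbb{P}_{\bm{E}}$ on $\mathrm{Val}(\bm{E})$. $F_X$ depends only on a subset $\mathrm{Pa}(X)\subseteq\bm{X}\cup\bm{E}$ of variables, the parents of $X$. Standing assumption, for every SCM including every one produced by an intervention (hard or soft): endogenous settings are fully determined by exogenous settings, so for each $\bm{e}\in\mathrm{Val}(\bm{E})$ there is a unique $\bm{x}\in\mathrm{Val}(\bm{X})$ with $\bm{x}=(F_X(\bm{x},\bm{e}))_{X\in\bm{X}}$; write $\mathcal{M}(\bm{e})=\bm{x}$, giving a function $\mathcal{M}\colon\mathrm{Val}(\bm{E})\to\mathrm{Val}(\bm{X})$. A soft intervention $i=(\bm{V}\gets\bm{f})$ on $\mathcal{M}$, with $\bm{V}\subseteq\bm{X}$ and $\bm{f}=(f_X)_{X\in\bm{V}}$,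 $f_X\colon\mathrm{Val}(\bm{X})\times\mathrm{Val}(\bm{E})\to\mathrm{Val}(X)$ depending at most on $\mathrm{Pa}(X)$, produces the SCM $\mathcal{M}_i=(\bm{X},\bm{E},\bm{F}^i,\mathbb{P}_{\bm{E}})$ with $F^i_X=f_X$ if $X\in\bm{V}$ and $F^i_X=F_X$ otherwise. Hard interventions are the special case in which all $f_X$ are constant. Viewing $\bm{f}$ as a joint function $\mathrm{Val}(\bm{X})\times\mathrm{Val}(\bm{E})\to\mathrm{Val}(\bm{V})$, the soft restriction set is $$\mathrm{SoftRst}(\mathcal{M}_i)=\{\bm{x}\in\mathrm{Val}(\bm{X})\mid\mathrm{Proj}(\bm{x},\bm{V})\in\mathrm{Image}(\bm{f})\}.$$ Low soft abstraction: let $\mathcal{L}=(\bm{X},\bm{E},\bm{F},\mathbb{P}_{\bm{E}})$ and $\mathcal{H}=(\bm{Y},\bm{U},\bm{G},\mathbb{P}_{\bm{U}})$ be SCMs with sets of admissible interventions $\mathcal{I}$ and $\mathcal{J}$, and let $\tau_{\bm{Y}}\colon\mathrm{Val}(\bm{X})\to\mathrm{Val}(\bm{Y})$ and $\tau_{\bm{U}}\colon\mathrm{Val}(\bm{E})\to\mathrm{Val}(\bm{U})$ be surjective. $\mathcal{H}$ is a low soft $\tau$-abstraction of $\mathcal{L}$ if there exists a surjective function $\omega\colon\mathcal{I}\to\mathcal{J}$ such that for every $i\in\mathcal{I}$ $$\mathrm{SoftRst}(\mathcal{H}_{\omega(i)})=\{\tau_{\bm{Y}}(\bm{x})\mid\bm{x}\in\mathrm{SoftRst}(\mathcal{L}_i)\}$$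 and, for every $\bm{e}\in\mathrm{Val}(\bm{E})$, $\tau_{\bm{Y}}(\mathcal{L}_i(\bm{e}))=\mathcal{H}_{\omega(i)}(\tau_{\bm{U}}(\bm{e}))$. *)

(* Defs.v *)
From HB Require Import structures.
From mathcomp Require Import all_boot all_order all_algebra.
From mathcomp Require Import all_classical all_reals all_analysis.

Set Implicit Arguments.
Unset Strict Implicit.
Unset Printing Implicit Defensive.

Local Open Scope classical_set_scope.

(* Neither the variables nor their domains are required to be finite. Exogenous
   domains are [pointedType]s only because measurable spaces are pointed in
   MathComp-Analysis; they are inhabited anyway as soon as [Val(E)] carries a
   probability measure. *)
Record signature := Signature {
  endo : Type;
  exo : Type;
  endo_val : endo -> Type;
  exo_val : exo -> pointedType;
  parents : endo -> set (endo + exo)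
}.

Definition Val (T : Type) (D : T -> Type) (V : set T) : Type :=
  forall v : V, D (val v).

Definition Proj (T : Type) (D : T -> Type) (x : forall v, D v) (V : set T) :
  Val D V := fun v => x (val v).

Arguments Proj {T D} x V.

Section Interventions.
Variable S : signature.

Definition endo_setting : Type := forall v : endo S, endo_val v.
Definition exo_setting : pointedType := (forall u : exo S, exo_val u).

Definition depends_on (A : Type) (f : endo_setting -> exo_setting -> A)
    (W : set (endo S + exo S)) : Prop :=
  forall x x' e e',
    (forall v, W (inl v) -> x v = x' v) ->
    (forall u, W (inr u) -> e u = e' u) ->
    f x e = f x' e'.

(* As functional and propositional extensionality hold, two interventions are
   equal as soon as they have the same targets and the same functions. *)
Record intervention := Intervention {
  targets : set (endo S);
  ifun : forall v : targets, endo_setting -> exo_setting -> endo_val (val v);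
  ifun_parents : forall v : targets, depends_on (ifun v) (parents (val v))
}.

Definition joint (i : intervention) (x : endo_setting) (e : exo_setting) :
  Val (@endo_val S) (targets i) := fun v => ifun v x e.

Definition SoftRst (i : intervention) : set endo_setting :=
  [set x | range (fun p : endo_setting * exo_setting => @joint i p.1 p.2)
             (Proj x (targets i))].

Definition equations : Type :=
  forall v : endo S, endo_setting -> exo_setting -> endo_val v.

Definition replace_equations (F : equations) (i : intervention) : equations :=
  fun v => match pselect (v \in targets i) with
           | left vi => @ifun i (exist _ v vi)
           | right _ => F v
           end.

Definition is_solution (F : equations) (e : exo_setting) (x : endo_setting) :
  Prop := x = (fun v => F v x e).

Lemma single_subproof (V : endo S) (v : [set V]) : V = val v.
Proof. by case: v => v /= /set_mem ->. Qed.

Definition single_fun (V : endo S)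
    (g : endo_setting -> exo_setting -> endo_val V) (v : [set V]) :
    endo_setting -> exo_setting -> endo_val (val v) :=
  eq_rect V (fun w => endo_setting -> exo_setting -> endo_val w) g
    (val v) (single_subproof v).

Lemma single_fun_parents (V : endo S)
    (g : endo_setting -> exo_setting -> endo_val V)
    (hg : depends_on g (parents V)) (v : [set V]) :
  depends_on (single_fun g v) (parents (val v)).
Proof. by rewrite /single_fun; case: _ / (single_subproof v). Qed.

(* The intervention [V <- g] on a single variable. *)
Definition single (V : endo S) (g : endo_setting -> exo_setting -> endo_val V)
    (hg : depends_on g (parents V)) : intervention :=
  @Intervention [set V] (single_fun g) (single_fun_parents hg).

Lemma replace_equations_parents (F : equations) (i : intervention) :
  (forall v, depends_on (F v) (parents v)) ->
  forall v, depends_on (replace_equations F i v) (parents v).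
Proof.
move=> hF v; rewrite /replace_equations; case: pselect => [vi|_]; last exact: hF.
exact: (@ifun_parents i (exist _ v vi)).
Qed.

(* Two successive interventions have the effect of a single one, which assigns
   an equation to every variable. *)
Lemma replace_equations_twice (F : equations) (i k : intervention) :
  (forall v, depends_on (F v) (parents v)) ->
  exists l, replace_equations (replace_equations F i) k = replace_equations F l.
Proof.
move=> hF; set G := replace_equations (replace_equations F i) k.
have hG : forall v, depends_on (G v) (parents v).
  by do 2!apply: replace_equations_parents.
exists (@Intervention setT (fun v => G (val v)) (fun v => hG (val v))).
apply: functional_extensionality_dep => v; rewrite /replace_equations.
by case: pselect => // -[]; rewrite inE.
Qed.

End Interventions.

Arguments depends_on {S A} f W.
Arguments single {S V g} hg.

(* The sigma-algebra on [Val(E)] is arbitrary: it is the one generated by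
   [exo_events]. The field [solvable] is the standing assumption that the
   equations have exactly one solution after every (hard or soft) intervention;
   for the intervention with no target, this is unique solvability of the model
   itself. *)
Record scm (R : realType) := SCM {
  sig :> signature;
  eqs : equations sig;
  eqs_parents : forall v : endo sig, depends_on (eqs v) (parents v);
  solvable : forall (i : intervention sig) (e : exo_setting sig),
    exists! x, is_solution (replace_equations eqs i) e x;
  exo_events : set (set (exo_setting sig));
  exo_prob : probability (g_sigma_algebraType exo_events) R
}.

Section Models.
Variable R : realType.

Lemma scm_solvable (M : scm R) (e : exo_setting M) :
  exists! x, is_solution (@eqs R M) e x.
Proof.
have h0 (v : set0 : set (endo M)) : False by case: v => v; rewrite inE.
pose f (v : set0 : set (endo M)) :
    endo_setting M -> exo_setting M -> endo_val (val v) :=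
  False_rect _ (h0 v).
have hf v : depends_on (f v) (parents (val v)) by case: (h0 v).
suff <- : replace_equations (@eqs R M) (Intervention hf) = @eqs R M
  by exact: solvable.
apply: functional_extensionality_dep => v; rewrite /replace_equations.
by case: pselect => //= v0; case: (h0 (exist _ v v0)).
Qed.

(* [M(e)] *)
Definition solution (M : scm R) (e : exo_setting M) : endo_setting M :=
  projT1 (cid (scm_solvable e)).

Lemma intervene_solvable (M : scm R) (i k : intervention M)
    (e : exo_setting M) :
  exists! x,
    is_solution (replace_equations (replace_equations (@eqs R M) i) k) e x.
Proof.
have [l ->] := replace_equations_twice i k (@eqs_parents R M).
exact: solvable.
Qed.

(* [M_i] *)
Definition intervene (M : scm R) (i : intervention M) : scm R :=
  @SCM R M (replace_equations (@eqs R M) i)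
    (@replace_equations_parents M (@eqs R M) i (@eqs_parents R M))
    (intervene_solvable i) (@exo_events R M) (exo_prob M).

(* [omega] satisfies the conditions in the definition of a low soft
   abstraction. Its domain and codomain are the subtypes of admissible
   interventions, so that equality of two such functions is equality on [I]. *)
Definition low_soft_map (L H : scm R)
    (I : set (intervention L)) (J : set (intervention H))
    (tauY : endo_setting L -> endo_setting H)
    (tauU : exo_setting L -> exo_setting H) (omega : I -> J) : Prop :=
  [/\ set_surj [set: I] [set: J] omega,
      forall i : I, SoftRst (val (omega i)) = tauY @` SoftRst (val i) &
      forall (i : I) (e : exo_setting L),
        tauY (solution (M := intervene (val i)) e) =
        solution (M := intervene (val (omega i))) (tauU e)].

Definition low_soft_abstraction (L H : scm R)
    (I : set (intervention L)) (J : set (intervention H))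
    (tauY : endo_setting L -> endo_setting H)
    (tauU : exo_setting L -> exo_setting H) : Prop :=
  exists omega : I -> J, low_soft_map tauY tauU omega.

End Models.

(* Main.v *)
Require Import Defs.
From HB Require Import structures.
From mathcomp Require Import all_boot all_order all_algebra.
From mathcomp Require Import all_classical all_reals all_analysis.

Local Open Scope classical_set_scope.

(* Exchanging the two interventions j and j' in the values of omega gives a
   second map. Their images agree by hypothesis, so only H_j = H_j' needs an
   argument: by hypothesis H_j(u) and H_j'(u) give V the same value c, so both
   solve the model under the hard intervention V <- c, whose solution is
   unique. *)

Lemma solutionP (R : realType) (M : scm R) (e : exo_setting M) :
  is_solution (@eqs R M) e (solution e).
Proof. by rewrite /solution; case: cid => x []. Qed.

(** The transport in [single_fun] is here along a proof of [V = V], which proof irrelevance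
    identifies with [erefl]. *)
Lemma single_funE {S : signature} (V : endo S)
    (g : endo_setting S -> exo_setting S -> endo_val V)
    (VV : V \in [set V]) : single_fun g (exist _ V VV) = g.
Proof.
rewrite /single_fun.
by rewrite (Prop_irrelevance (single_subproof (exist _ V VV)) erefl).
Qed.

(** Isolates the only equation that involves [g], so that solutions under different interventions on
    [V] can be compared. *)
Lemma is_solution_single {S : signature} (F : equations S) (V : endo S)
    (g : endo_setting S -> exo_setting S -> endo_val V)
    (hg : depends_on g (parents V)) (e : exo_setting S) (x : endo_setting S) :
  is_solution (replace_equations F (single hg)) e x <->
  x V = g x e /\ forall v, v <> V -> x v = F v x e.
Proof.
split=> [xE|[xV xF]].
  split=> [|v vV]; rewrite {1}xE /replace_equations; case: pselect => //= h.
  - by rewrite single_funE.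
  - by case: h; rewrite inE.
  - by case: vV; move/set_mem: h.
apply: functional_extensionality_dep => v; rewrite /replace_equations.
case: pselect => /= [vV|vV]; last by apply: xF => vE; apply: vV; rewrite inE.
have vE : v = V by move/set_mem: (vV).
by subst v; rewrite single_funE.
Qed.

Lemma solution_single_eq (R : realType) (M : scm R) (V : endo M)
    (g g' : endo_setting M -> exo_setting M -> endo_val V)
    (hg : depends_on g (parents V)) (hg' : depends_on g' (parents V))
    (e : exo_setting M) :
  solution (M := intervene (single hg)) e V =
    solution (M := intervene (single hg')) e V ->
  solution (M := intervene (single hg)) e =
    solution (M := intervene (single hg')) e.
Proof.
have /is_solution_single[_ xF] := @solutionP R (intervene (single hg)) e.
have /is_solution_single[_ yF] := @solutionP R (intervene (single hg')) e.
set x := solution _ in xF *; set y := solution _ in yF * => xy.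
(* A constant depends on no variable, so it is allowed whatever the parents of [V]; [solvable]
   covers it even if it is not admissible. *)
have hc : depends_on (fun _ _ => x V) (parents V) by [].
have [z [_ z_uniq]] := solvable (single hc) e.
have <- : z = x by apply: z_uniq; apply/is_solution_single; split.
by apply: z_uniq; apply/is_solution_single; split.
Qed.

(** An element of [Val] over a singleton is determined by its one coordinate. This brings the soft
    restriction set into a form to which the equality of images applies. *)
Lemma SoftRst_single {S : signature} (V : endo S)
    (g : endo_setting S -> exo_setting S -> endo_val V)
    (hg : depends_on g (parents V)) :
  SoftRst (single hg) =
  [set x | range (fun p : endo_setting S * exo_setting S => g p.1 p.2) (x V)].
Proof.
have VV : V \in [set V] by rewrite inE.
apply/seteqP; split=> x [p _ px]; exists p => //.
  by move/(congr1 (fun f => f (exist _ V VV))): px; rewrite /joint /= single_funE.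
apply: functional_extensionality_dep => -[v vV].
have vE : v = V by move/set_mem: (vV).
by subst v; rewrite /joint /= single_funE.
Qed.

Definition transpose {T : Type} (a b x : T) : T :=
  if pselect (x = a) then b else if pselect (x = b) then a else x.

Lemma transposeL {T : Type} (a b : T) : transpose a b a = b.
Proof. by rewrite /transpose; case: pselect. Qed.

Lemma transposeK {T : Type} (a b : T) : involutive (transpose a b).
Proof.
move=> x; rewrite /transpose.
by do 4?[case: pselect => //= ?]; congruence.
Qed.

(** Meant for two choices of [f]: the soft restriction set, and the solution at a fixed exogenous
    setting. Surjectivity aside, the conditions on [omega] see its values only through these. *)
Lemma transpose_inv {T A : Type} (f : T -> A) (a b x : T) :
  f a = f b -> f (transpose a b x) = f x.
Proof. rewrite /transpose => ab; case: pselect => /= [->//|_].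
by case: pselect => //= ->. Qed.

Theorem theorem1 (R : realType) (H : scm R) (J : set (intervention H))
    (V : endo H)
    (g g' : endo_setting H -> exo_setting H -> endo_val V)
    (hg : depends_on g (parents V)) (hg' : depends_on g' (parents V))
    (Jg : J (single hg)) (Jg' : J (single hg'))
    (neq : single hg <> single hg')
    (same_values : forall u : exo_setting H,
        Proj (solution (M := intervene (single hg)) u) [set V] =
        Proj (solution (M := intervene (single hg')) u) [set V])
    (same_image :
        range (fun p : endo_setting H * exo_setting H => g p.1 p.2) =
        range (fun p : endo_setting H * exo_setting H => g' p.1 p.2))
    (L : scm R) (I : set (intervention L))
    (tauY : endo_setting L -> endo_setting H)
    (tauU : exo_setting L -> exo_setting H)
    (tauY_surj : set_surj [set: endo_setting L] [set: endo_setting H] tauY)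
    (tauU_surj : set_surj [set: exo_setting L] [set: exo_setting H] tauU)
    (abs : low_soft_abstraction I J tauY tauU) :
  exists omega omega' : I -> J,
    [/\ low_soft_map tauY tauU omega, low_soft_map tauY tauU omega' &
        omega <> omega'].
Proof.
have [omega [osurj oRst osol]] := abs.
pose j : J := exist _ (single hg) (mem_set Jg).
pose j' : J := exist _ (single hg') (mem_set Jg').
have jj' : j <> j' by move/(congr1 val).
have jRst : SoftRst (val j) = SoftRst (val j').
  by rewrite !SoftRst_single same_image.
have VV : V \in [set V] by rewrite inE.
have jsol u : solution (M := intervene (val j)) u =
              solution (M := intervene (val j')) u.
  apply: solution_single_eq.
  exact: (congr1 (fun f => f (exist _ V VV)) (same_values u)).
exists omega, (transpose j j' \o omega); split=> //.
  split=> [k _|i|i e] /=.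
  (* As the exchange is an involution, a preimage of the exchanged [k] under [omega] is a preimage
     of [k] under the new map. *)
  - have [i _ ik] := osurj (transpose j j' k) Logic.I.
    by exists i => //=; rewrite ik transposeK.
  - by rewrite (transpose_inv (fun k : J => SoftRst (val k))).
  - pose sol (k : J) : endo_setting H :=
      solution (M := intervene (val k)) (tauU e).
    by rewrite osol -[LHS](@transpose_inv _ _ sol j j' (omega i)) ?/sol ?jsol.
(* The maps differ wherever [omega] takes the value [j], which happens by surjectivity: the new map
   gives [j'] there. *)
have [i _ ij] := osurj j Logic.I.
by move/(congr1 (fun f => f i)); rewrite /= ij transposeL.
Qed.
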